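(* Let $X$ be a real Hilbert space, let $T\colon X\to X$ be nonexpansive, i.e., $\|Tx-Ty\|\le\|x-y\|$ for all $x,y\in X$, and define the displacement mapping $A=\operatorname{Id}-T$. Then the following hold: (i) $A$ is maximally monotone. (ii) $A$ is rectangular. (iii) $A$ is $\tfrac12$-cocoercive. (iv) $A^{-1}$ is strongly monotone with constant $\tfrac12$. (v) $A^{-1}$ is strictly monotone. (vi) $A$ is paramonotone.
   Context: $X$ is a real Hilbert space with inner product $\langle\cdot,\cdot\rangle$, and $X^*$ is identified with $X$; $\operatorname{Id}$ is the identity. A single-valued map is regarded as a set-valued operator with singleton values. For a set-valued operator $B\colon X\rightrightarrows X$: $\operatorname{gra}B=\{(x,x^* )\mid x^*\in Bx\}$, $\operatorname{dom}B=\{x\mid Bx\neq\varnothing\}$, $\operatorname{ran}B=\bigcup_{x}Bx$, and $B^{-1}$ is the set-valued operator with graph $\{(x^*,x)\mid x^*\in Bx\}$. $B$ is monotone if $\langle x-y,x^*-y^*\rangle\ge 0$ for all $(x,x^* ),(y,y^* )\in\operatorname{gra}B$; strictly monotone if moreover this inequality is strict whenever $x\neq y$; maximally monotone if it is monotone and no monotone operator has a graph properly containing $\operatorname{gra}B$; strongly monotone with constant $\beta>0$ if $B-\beta\operatorname{Id}$ is monotone. A map $S\colon X\to X$ is firmly nonexpansive if $\|Sx-Sy\|^2\le\langle x-y,Sx-Sy\rangle$ for all $x,y\in X$, and $S$ is $\tfrac12$-cocoercive if $\tfrac12 S$ is firmly nonexpansive. For monotone $B$ with nonempty graph, the Fitzpatrick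 function is $F_B(x,x^* )=\sup_{(a,a^* )\in\operatorname{gra}B}(\langle x,a^*\rangle+\langle a,x^*\rangle-\langle a,a^*\rangle)\in\,]-\infty,+\infty]$, with $\operatorname{dom}F_B=\{F_B<+\infty\}$; $B$ is rectangular if $\operatorname{dom}B\times\operatorname{ran}B\subseteq\operatorname{dom}F_B$; $B$ is paramonotone if whenever $(x,x^* ),(y,y^* )\in\operatorname{gra}B$ satisfy $\langle x-y,x^*-y^*\rangle=0$, then $(x,y^* ),(y,x^* )\in\operatorname{gra}B$. *)

(* Defs.v *)
From HB Require Import structures.
From mathcomp Require Import all_boot all_order all_algebra.
From mathcomp Require Import all_classical all_reals all_analysis.

Set Implicit Arguments.
Unset Strict Implicit.
Unset Printing Implicit Defensive.

Import Order.TTheory GRing.Theory Num.Theory.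
Import numFieldNormedType.Exports.

Local Open Scope classical_set_scope.
Local Open Scope ring_scope.

(* [{dot V for idfun}] is MathComp's type of symmetric positive definite
   bilinear forms on [V]; [inner_normE] says that the complete norm of [V] is
   the one induced by the form. *)
HB.mixin Record CompleteNormedModule_isHilbert (R : realType) V
    of CompleteNormedModule R V := {
  inner : {dot V for idfun} ;
  inner_normE : forall x : V, inner x x = `|x| ^+ 2
}.

#[short(type="hilbertType")]
HB.structure Definition Hilbert (R : realType) :=
  { V of CompleteNormedModule R V & CompleteNormedModule_isHilbert R V }.

Notation "'<< x , y >>" := (inner x y)
  (at level 0, x at level 99, y at level 99, format "''<<' x ,  y '>>'") : ring_scope.

Section Operators.
Variables (R : realType) (X : hilbertType R).

(* A set-valued operator [B : X => X] is a function [X -> set X]. *)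
Implicit Types (B C : X -> set X) (S T : X -> X).

Definition single_valued S : X -> set X := fun x => [set S x].

Definition gra B : set (X * X) := [set p | B p.1 p.2].
Definition dom B : set X := [set x | B x !=set0].
Definition ran B : set X := \bigcup_x B x.
Definition op_inv B : X -> set X := fun y => [set x | B x y].
Definition op_sub B C : X -> set X :=
  fun x => [set u - v | u in B x & v in C x].

Definition monotone_op B : Prop :=
  forall x xs y ys, gra B (x, xs) -> gra B (y, ys) ->
    0 <= '<<x - y, xs - ys>>.

Definition strictly_monotone_op B : Prop :=
  monotone_op B /\
  forall x xs y ys, gra B (x, xs) -> gra B (y, ys) ->
    x <> y -> 0 < '<<x - y, xs - ys>>.

Definition maximally_monotone_op B : Prop :=
  monotone_op B /\ ~ (exists C, monotone_op C /\ gra B `<` gra C).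

Definition strongly_monotone_op (beta : R) B : Prop :=
  0 < beta /\ monotone_op (op_sub B (single_valued (fun x => beta *: x))).

Definition fitzpatrick B (p : X * X) : \bar R :=
  ereal_sup [set ('<<p.1, a.2>> + '<<a.1, p.2>> - '<<a.1, a.2>>)%:E
            | a in gra B].

Definition dom_fitzpatrick B : set (X * X) :=
  [set p | (fitzpatrick B p < +oo)%E].

(* The Fitzpatrick function, hence rectangularity, is only considered for
   monotone operators with nonempty graph. *)
Definition rectangular B : Prop :=
  [/\ monotone_op B, gra B !=set0 & dom B `*` ran B `<=` dom_fitzpatrick B].

Definition paramonotone B : Prop :=
  monotone_op B /\
  forall x xs y ys, gra B (x, xs) -> gra B (y, ys) ->
    '<<x - y, xs - ys>> = 0 -> gra B (x, ys) /\ gra B (y, xs).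

Definition nonexpansive T : Prop := forall x y, `|T x - T y| <= `|x - y|.

Definition firmly_nonexpansive S : Prop :=
  forall x y, `|S x - S y| ^+ 2 <= '<<x - y, S x - S y>>.

Definition cocoercive (beta : R) S : Prop :=
  0 < beta /\ firmly_nonexpansive (fun x => beta *: S x).

Definition displacement T : X -> X := fun x => x - T x.

End Operators.

(* Main.v *)
(** With [d = x - y] and [u = A x - A y], nonexpansiveness of [T] reads
    [|d - u|^2 <= |d|^2], i.e. [|u|^2 <= 2 <d, u>]: this single inequality is
    cocoercivity of [A], and all the other claims follow from it. *)
Require Import Defs.
From mathcomp Require Import all_boot all_order all_algebra.
From mathcomp Require Import all_classical all_reals all_analysis.
From mathcomp Require Import ring lra.

Set Implicit Arguments.
Unset Strict Implicit.
Unset Printing Implicit Defensive.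

Import Order.TTheory GRing.Theory Num.Theory.
Import numFieldNormedType.Exports.

Local Open Scope ring_scope.

Lemma subrACA (V : zmodType) (x y z t : V) : x - y - (z - t) = x - z - (y - t).
Proof. by rewrite !opprD addrACA. Qed.

Section InnerProduct.
Variables (R : realType) (X : hilbertType R).
Implicit Types (x y z : X) (a : R).

Lemma innerC x y : '<<x, y>> = '<<y, x>>.
Proof. by rewrite hermC expr0 mul1r. Qed.

Lemma innerBl x y z : '<<x - y, z>> = '<<x, z>> - '<<y, z>>.
Proof. exact: linearBl. Qed.

Lemma innerBr x y z : '<<x, y - z>> = '<<x, y>> - '<<x, z>>.
Proof. exact: linearBr. Qed.

Lemma innerZl a x y : '<<a *: x, y>> = a * '<<x, y>>.
Proof. exact: linearZl_LR. Qed.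

Lemma innerZr a x y : '<<x, a *: y>> = a * '<<x, y>>.
Proof. by rewrite innerC innerZl innerC. Qed.

Lemma sqr_normB x y : `|x - y| ^+ 2 = `|x| ^+ 2 - 2 * '<<x, y>> + `|y| ^+ 2.
Proof.
by rewrite -!inner_normE innerBl !innerBr (innerC y x); ring.
Qed.

(** Young's inequality, used in place of Cauchy-Schwarz: it involves only squared norms and inner
    products, so later estimates close by linear arithmetic in these quantities. *)
Lemma inner_le_sqr_norm x y : 2 * '<<x, y>> <= `|x| ^+ 2 + `|y| ^+ 2.
Proof. by have := sqr_ge0 `|x - y|; rewrite sqr_normB; lra. Qed.

Lemma sqr_norm_le0 x : `|x| ^+ 2 <= 0 -> x = 0.
Proof.
by move=> x0; apply/normr0_eq0/eqP; rewrite -sqrf_eq0 eq_le x0 sqr_ge0.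
Qed.

End InnerProduct.

Lemma gra_single_valuedE (R : realType) (X : hilbertType R) (S : X -> X) x u :
  gra (single_valued S) (x, u) = (u = S x).
Proof. by []. Qed.

Lemma gra_op_invE (R : realType) (X : hilbertType R) (B : X -> set X) x u :
  gra (op_inv B) (u, x) = gra B (x, u).
Proof. by []. Qed.

Section HalfCocoercive.
Variables (R : realType) (X : hilbertType R) (A : X -> X).
Hypothesis A_coco : cocoercive 2^-1 A.

(** Firm nonexpansiveness of [2^-1 *: A], multiplied by 4. The later properties of [A] and its
    inverse all rest on this form. *)
Lemma half_cocoercive_sqr_norm_le x y :
  `|A x - A y| ^+ 2 <= 2 * '<<x - y, A x - A y>>.
Proof.
have := A_coco.2 x y.
rewrite -scalerBr innerZr normrZ exprMn ger0_norm ?invr_ge0//; lra.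
Qed.

Lemma half_cocoercive_inner_ge0 x y : 0 <= '<<x - y, A x - A y>>.
Proof.
by have := half_cocoercive_sqr_norm_le x y; have := sqr_ge0 `|A x - A y|; lra.
Qed.

(** With [d = x - y] and [u = A x - A y], cocoercivity and Young give
    [2 |u|^2 <= 2 <2 d, u> <= 4 |d|^2 + |u|^2]. *)
Lemma half_cocoercive_lipschitz x y :
  `|A x - A y| ^+ 2 <= 4 * `|x - y| ^+ 2.
Proof.
have := half_cocoercive_sqr_norm_le x y.
have := inner_le_sqr_norm (2 *: (x - y)) (A x - A y).
by rewrite innerZl normrZ exprMn normr_nat; lra.
Qed.

Lemma half_cocoercive_monotone : monotone_op (single_valued A).
Proof.
move=> x xs y ys; rewrite 2!gra_single_valuedE => -> ->.
exact: half_cocoercive_inner_ge0.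
Qed.

(* Minty's trick: test [C] against [A] at the point [x + w / 4]; as [A] is
   2-Lipschitz, this is close enough to [x] to force [w = 0]. *)
Lemma half_cocoercive_no_monotone_extension (C : X -> set X) x u :
  monotone_op C -> (gra (single_valued A) `<=` gra C)%classic ->
  gra C (x, u) -> u = A x.
Proof.
move=> Cmono AC Cxu; set w := u - A x; set z := x + 4^-1 *: w.
have zx : z - x = 4^-1 *: w by rewrite /z addrAC subrr add0r.
have Cz : gra C (z, A z) by exact: AC.
have := Cmono _ _ _ _ Cz Cxu; rewrite zx innerZl.
have -> : A z - u = (A z - A x) - w by rewrite /w opprB subrKA.
rewrite innerBr inner_normE => h.
have := inner_le_sqr_norm w (A z - A x).
have := half_cocoercive_lipschitz z x.
rewrite zx normrZ exprMn ger0_norm ?invr_ge0// => lip cs.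
(* With [v = A z - A x], [h] says [|w|^2 <= <w, v>], and [lip] says [|v|^2 <= |w|^2 / 4]. By Young,
   [2 |w|^2 <= |w|^2 + |w|^2 / 4], hence [w = 0]. *)
by apply/eqP; rewrite -subr_eq0; apply/eqP/sqr_norm_le0; rewrite -/w; lra.
Qed.

Lemma half_cocoercive_maximally_monotone :
  maximally_monotone_op (single_valued A).
Proof.
split; first exact: half_cocoercive_monotone.
move=> [C [Cmono [AC CA]]]; apply: CA => -[x u] Cxu.
exact: half_cocoercive_no_monotone_extension Cxu.
Qed.

Lemma half_cocoercive_rectangular : rectangular (single_valued A).
Proof.
split; first exact: half_cocoercive_monotone.
  by exists (0, A 0).
move=> [x xs] [/= _ [y _ ->]].
(* A bound independent of the graph point [a]: cocoercivity gives [- <a - y, v> <= - |v|^2 / 2], and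
   Young bounds [<x - y, v> - |v|^2 / 2] by [|x - y|^2 / 2]. *)
apply: (@le_lt_trans _ _ (2^-1 * `|x - y| ^+ 2 + '<<x, A y>>)%:E);
  last exact: ltry.
apply: ge_ereal_sup => _ [[a _] -> <-] /=; rewrite lee_fin.
(* The expression is [<x, A y> + <x - y, v> - <a - y, v>], [v = A a - A y]. *)
have := half_cocoercive_sqr_norm_le a y.
have := inner_le_sqr_norm (x - y) (A a - A y).
by rewrite !innerBl !innerBr; lra.
Qed.

(** Exchanging points and values turns cocoercivity into
    [<A u - A v, u - v> >= |A u - A v|^2 / 2]. *)
Lemma half_cocoercive_inv_strongly_monotone :
  strongly_monotone_op 2^-1 (op_inv (single_valued A)).
Proof.
split; first by rewrite invr_gt0.
move=> x xs y ys [u /= -> [_ -> <-]] [v /= -> [_ -> <-]].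
have -> : u - 2^-1 *: A u - (v - 2^-1 *: A v) = (u - v) - 2^-1 *: (A u - A v).
  by rewrite scalerBr subrACA.
rewrite innerBr innerZr inner_normE innerC.
by have := half_cocoercive_sqr_norm_le u v; lra.
Qed.

Lemma half_cocoercive_inv_strictly_monotone :
  strictly_monotone_op (op_inv (single_valued A)).
Proof.
split=> xs x ys y; rewrite 2!gra_op_invE 2!gra_single_valuedE => -> ->.
  by rewrite innerC; exact: half_cocoercive_inner_ge0.
(* Distinct points of the inverse are distinct values of [A]; a nonpositive product would force
   [|A x - A y|^2 <= 0]. *)
move=> Axy; rewrite innerC ltNge; apply/negP => le0; apply/Axy/eqP; rewrite -subr_eq0.
by apply/eqP/sqr_norm_le0; have := half_cocoercive_sqr_norm_le x y; lra.
Qed.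

Lemma half_cocoercive_paramonotone : paramonotone (single_valued A).
Proof.
split=> [|x xs y ys]; first exact: half_cocoercive_monotone.
rewrite 2!gra_single_valuedE => -> -> eq0.
(* A zero product makes the cocoercivity bound on [|A x - A y|^2] vanish; with equal values,
   exchanging them changes nothing. *)
have Axy : A x = A y.
  apply/eqP; rewrite -subr_eq0; apply/eqP/sqr_norm_le0.
  by have := half_cocoercive_sqr_norm_le x y; rewrite eq0 mulr0.
by rewrite Axy.
Qed.

End HalfCocoercive.

Lemma displacement_cocoercive (R : realType) (X : hilbertType R) (T : X -> X) :
  nonexpansive T -> cocoercive 2^-1 (displacement T).
Proof.
move=> T_nonexp; split=> [|x y]; first by rewrite invr_gt0.
rewrite -scalerBr innerZr normrZ exprMn ger0_norm ?invr_ge0//.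
have -> : displacement T x - displacement T y = (x - y) - (T x - T y).
  by rewrite /displacement subrACA.
have : `|T x - T y| ^+ 2 <= `|x - y| ^+ 2.
  by rewrite ler_sqr ?nnegrE// T_nonexp.
(* After expansion, the terms in [<d, t>] cancel and the goal reduces to [|t|^2 <= |d|^2]. *)
move: (x - y) (T x - T y) => d t.
by rewrite sqr_normB innerBr inner_normE; lra.
Qed.

Theorem theorem6p1 (R : realType) (X : hilbertType R) (T : X -> X)
    (hT : nonexpansive T) :
  let A : X -> X := displacement T in
  maximally_monotone_op (single_valued A) /\
  rectangular (single_valued A) /\
  cocoercive (2^-1) A /\
  strongly_monotone_op (2^-1) (op_inv (single_valued A)) /\
  strictly_monotone_op (op_inv (single_valued A)) /\
  paramonotone (single_valued A).
Proof.
move=> A; have A_coco : cocoercive 2^-1 A by exact: displacement_cocoercive.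
split; first exact: half_cocoercive_maximally_monotone.
split; first exact: half_cocoercive_rectangular.
split; first exact: A_coco.
split; first exact: half_cocoercive_inv_strongly_monotone.
split; first exact: half_cocoercive_inv_strictly_monotone.
exact: half_cocoercive_paramonotone.
Qed.
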